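(* Suppose that $X$ is a Fréchet sequence space over $\mathbb{Z}$ in which the sequence $(e_n)_{n \in \mathbb{Z}}$ of canonical vectors is a basis, $w := (w_n)_{n \in \mathbb{Z}}$ is a sequence of nonzero scalars, and the bilateral weighted backward shift $B_w$ is a well-defined operator on $X$. Then $B_w$ is Li-Yorke chaotic if and only if the following conditions hold: (a) The sequence $(w_{-n} \cdots w_{-1} e_{-n})_{n \in \mathbb{N}}$ has a subsequence converging to zero in $X$. (b) There is a vector $(x_n)_{n \in \mathbb{Z}} \in X$ such that the sequence of vectors $(w_j \cdots w_{j+n-1} x_{j+n})_{j \in \mathbb{Z}}$, $n \in \mathbb{N}$, does not converge to $0$ in $X$ as $n \to \infty$.
   Context: $\mathbb{K}$ denotes $\mathbb{R}$ or $\mathbb{C}$ (the scalar field), and $\mathbb{N} = \{1,2,3,\ldots\}$. A Fréchet sequence space over $\mathbb{Z}$ is a Fréchet space $X$ which is a vector subspace of the product space $\mathbb{K}^{\mathbb{Z}}$ such that the inclusion map $X \to \mathbb{K}^{\mathbb{Z}}$ is continuous. The canonical vectors $e_n := (\delta_{n,j})_{j \in \mathbb{Z}}$ ($n \in \mathbb{Z}$) form a basis of $X$ if they belong to $X$ and $x = \sum_{n=-\infty}^{\infty} x_n e_n$ for all $x = (x_n)_{n \in \mathbb{Z}} \in X$. The bilateral weighted backward shift is $B_w((x_n)_{n\in\mathbb{Z}}) := (w_n x_{n+1})_{n \in \mathbb{Z}}$; it is a well-defined operator on $X$ if it maps $X$ into itself (it is then automatically continuous). For $i \leq j$, $w_i\cdots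 w_j$ denotes the product of all $w_l$ with $i \leq l \leq j$. A continuous map $g : M \to M$ on a metric space $(M,d)$ is Li-Yorke chaotic if there is an uncountable set $S \subset M$ such that for all distinct $x,y \in S$, $\liminf_{n \to \infty} d(g^n(x),g^n(y)) = 0$ and $\limsup_{n\to\infty} d(g^n(x),g^n(y)) > 0$. A Fréchet space is regarded as a metric space via any translation-invariant metric inducing its topology. *)

(* Defs.v *)
From HB Require Import structures.
From mathcomp Require Import all_boot all_order all_algebra.
From mathcomp Require Import all_classical all_reals all_analysis.
From mathcomp Require Import complex.

Set Implicit Arguments.
Unset Strict Implicit.
Unset Printing Implicit Defensive.

Import Order.TTheory GRing.Theory Num.Theory.
Import numFieldNormedType.Exports.

Local Open Scope classical_set_scope.
Local Open Scope ring_scope.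

Definition is_metric (R : realType) (M : Type) (d : M -> M -> R) : Prop :=
  [/\ forall x y, 0 <= d x y,
      forall x y, d x y = 0 <-> x = y,
      forall x y, d x y = d y x
    & forall x y z, d x z <= d x y + d y z].

Definition induces_topology (R : realType) (M : topologicalType)
    (d : M -> M -> R) : Prop :=
  forall x : M, nbhs x = nbhs_ball_ (fun y e => [set z | d y z < e]) x.

Definition invariant_metric (R : realType) (K : numFieldType) (X : tvsType K)
    (d : X -> X -> R) : Prop :=
  [/\ is_metric d, induces_topology d
    & forall x y z, d (x + z) (y + z) = d x y].

Definition complete_metric (R : realType) (M : Type)
    (d : M -> M -> R) : Prop :=
  forall u : nat -> M,
    (forall e, 0 < e -> exists N, forall m n,
       (N <= m)%N -> (N <= n)%N -> d (u m) (u n) < e) ->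
  exists l, d (u n) l @[n --> \oo] --> (0 : R).

(* Local convexity is part of [tvsType].  The uniform structure of a [tvsType]
   need not be the translation-invariant one, so completeness is expressed
   through an invariant metric instead; it does not depend on the choice of
   that metric. *)
Definition is_frechet (R : realType) (K : numFieldType) (X : tvsType K) : Prop :=
  exists d : X -> X -> R, invariant_metric d /\ complete_metric d.

HB.mixin Record isSeqSpace (K : numFieldType) (S : pred (int -> K)) X
    & Topological X & SubType (int -> K) S X := {
  val_continuous : continuous (val : X -> {ptws int -> K})
}.

(* A linear subspace of K^Z, with underlying set S, carrying a locally convex
   topology for which the inclusion [val] into the product space is
   continuous. *)
#[short(type="seqSpaceType")]
HB.structure Definition SeqSpace (K : numFieldType) (S : pred (int -> K)) :=
  {X of Tvs K X & GRing.SubLmodule K S X & isSeqSpace K S X}.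

Definition canonical_vectors (K : numFieldType) (S : pred (int -> K))
    (X : seqSpaceType S) (e : int -> X) : Prop :=
  forall n, val (e n) = fun j => (n == j)%:R.

(* The two tails of the bilateral series converge independently. *)
Definition bilateral_cvg (K : numFieldType) (X : tvsType K)
    (u : int -> X) (l : X) : Prop :=
  (fun N : nat * nat => \sum_(0 <= k < N.1) u k%:Z
                        + \sum_(1 <= k < N.2) u (- k%:Z))
    @ (\oo, \oo) --> l.

Definition canonical_basis (K : numFieldType) (S : pred (int -> K))
    (X : seqSpaceType S) (e : int -> X) : Prop :=
  canonical_vectors e /\
  forall x : X, bilateral_cvg (fun n => (val x : int -> K) n *: e n) x.

Definition bshift (K : numFieldType) (w x : int -> K) : int -> K :=
  fun n => w n * x (n + 1).

(* The product of the n consecutive weights w_i ... w_(i + n - 1). *)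
Definition wprod (K : numFieldType) (w : int -> K) (i : int) (n : nat) : K :=
  \prod_(0 <= l < n) w (i + l%:Z).

Definition li_yorke_chaotic (R : realType) (M : topologicalType)
    (d : M -> M -> R) (g : M -> M) : Prop :=
  continuous g /\
  exists S : set M, ~ countable S /\
    forall x y, S x -> S y -> x <> y ->
      limn_einf (fun n => (d (iter n g x) (iter n g y))%:E) = 0%E /\
      (0 < limn_esup (fun n => (d (iter n g x) (iter n g y))%:E))%E.

(* Main.v *)
(* Write T = B_w. By Banach-Steinhaus, applied to the partial sums of the basis
   expansion, T is continuous, and the maps x |-> x_{-n} e_{-n} are
   equicontinuous. Li-Yorke chaos amounts to the existence of a semi-irregular
   vector z (its orbit accumulates at 0 without converging to 0), since the
   nonzero multiples of z are again semi-irregular.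
   If z is semi-irregular and z_j <> 0, the coordinate of index j - n of T^n z
   is a constant times w_{-m} ... w_{-1} with m = n - j, so equicontinuity gives
   (a).
   Conversely, (a) says that the orbit of e_0 accumulates at 0, and then so does
   the orbit of every finitely supported vector. Hence the vectors whose orbit
   accumulates at 0 form a dense G_delta set G. By Baire, the vector x of (b) is
   a sum of two elements of G; since T^n x does not tend to 0, one of them is
   semi-irregular. *)

Require Import Defs.
From mathcomp Require Import all_boot all_order all_algebra.
From mathcomp Require Import all_classical all_reals all_analysis.
From mathcomp Require Import complex lra zify.

Set Implicit Arguments.
Unset Strict Implicit.
Unset Printing Implicit Defensive.

Import Order.TTheory GRing.Theory Num.Theory.
Import numFieldNormedType.Exports.

Local Open Scope classical_set_scope.
Local Open Scope ring_scope.

(** * Neighbourhoods in a metric and the Baire category theorem *)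

Lemma inv_succ_lt (R : realType) (e : R) : 0 < e ->
  exists N, forall n, (N <= n)%N -> n.+1%:R^-1 < e.
Proof.
move=> e0; have [N _ HN] := near_infty_natSinv_lt (PosNum e0).
by exists N => n Nn; exact: HN.
Qed.

Lemma nbhs_metricP (R : realType) (M : topologicalType) (d : M -> M -> R)
    (dtop : induces_topology d) (x : M) (A : set M) :
  nbhs x A <-> exists2 e, 0 < e & forall z, d x z < e -> A z.
Proof.
by rewrite dtop; split=> [[e e0 eA]|[e e0 eA]]; exists e => // z; exact: eA.
Qed.

Lemma cvg_metricP (R : realType) (M : topologicalType) (d : M -> M -> R)
    (dtop : induces_topology d) (u : nat -> M) (l : M) :
  u @ \oo --> l <->
  forall e, 0 < e -> exists N, forall n, (N <= n)%N -> d l (u n) < e.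
Proof.
split=> [ul e e0|h A /(nbhs_metricP dtop)[e e0 eA]].
  have /ul[N _ HN] : nbhs l [set z | d l z < e].
    by apply/(nbhs_metricP dtop); exists e.
  by exists N => n Nn; exact: (HN n).
by have [N HN] := h e e0; exists N => // n /= Nn; apply/eA/HN.
Qed.

Lemma metric_ball_open (R : realType) (M : topologicalType) (d : M -> M -> R)
    (dm : is_metric d) (dtop : induces_topology d) (x : M) (r : R) :
  open [set z | d x z < r].
Proof.
case: dm => _ _ _ dtri; rewrite openE => z /= zr.
apply/(nbhs_metricP dtop); exists (r - d x z); first by rewrite subr_gt0.
by move=> y; rewrite ltrBrDl; apply: le_lt_trans.
Qed.

(** Nested closed balls: the ball of stage n lies in [F n] and in the preceding ball, with radius at
    most 1/(n+1). The centres are Cauchy, and their limit stays in every ball. *)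
Lemma complete_metric_Baire (R : realType) (M : topologicalType)
    (d : M -> M -> R) (dm : is_metric d) (dtop : induces_topology d)
    (dcpl : complete_metric d) (F : nat -> set M) :
  (forall n, open (F n) /\ dense (F n)) -> dense (\bigcap_n F n).
Proof.
move=> FD; have [d0 dx0 dC dtri] := dm.
have step (O : set M) n : O !=set0 -> open O ->
    exists q : M * R, [/\ 0 < q.2, q.2 <= n.+1%:R^-1 &
      forall z, d q.1 z <= q.2 -> O z /\ F n z].
  move=> O0 oO; have [oF dF] := FD n.
  have [y OFy] := dF _ O0 oO.
  have /(nbhs_metricP dtop)[s s0 sOF] : nbhs y (O `&` F n).
    by apply: open_nbhs_nbhs; split => //; exact: openI.
  (* Halving [s] puts the closed ball of the new radius inside the open ball of radius [s]. *)
  exists (y, Num.min (s / 2) n.+1%:R^-1); split => /=.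
  - by rewrite lt_min divr_gt0//= invr_gt0 ltr0n.
  - by rewrite ge_min lexx orbT.
  - move=> z yz; apply: sOF; apply: le_lt_trans yz _.
    by rewrite gt_min ltr_pdivrMr// ltr_pMr// ltr1n.
have dxx x : d x x = 0 by apply/dx0.
(* The guard on the radius makes [f] total; it always holds along the construction, whose radii are
   positive. *)
have /choice[f Hf] : forall np : nat * (M * R), exists q : M * R, 0 < np.2.2 ->
    [/\ 0 < q.2, q.2 <= np.1.+1%:R^-1 & forall z, d q.1 z <= q.2 ->
      d np.2.1 z < np.2.2 /\ F np.1 z].
  move=> [n [x r]] /=; have [r0|r0] := pselect (0 < r); last first.
    by exists (x, r).
  have [||q Hq] := step [set z | d x z < r] n.
  - by exists x; rewrite /= dxx.
  - exact: metric_ball_open.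
  - by exists q.
move=> O O0 oO; have [q0 [q00 q01 q0O]] := step O 0%N O0 oO.
pose u := fix u n := if n is m.+1 then f (n, u m) else q0.
have u0 n : 0 < (u n).2.
  by elim: n => [//|n IH] /=; have [] := Hf (n.+1, u n) IH.
have u1 n : (u n).2 <= n.+1%:R^-1.
  by case: n => [//|n] /=; have [] := Hf (n.+1, u n) (u0 n).
have usub n z : d (u n.+1).1 z <= (u n.+1).2 -> d (u n).1 z <= (u n).2.
  by move=> uz; have [_ _ /(_ z uz)[/ltW]] := Hf (n.+1, u n) (u0 n).
have unest n k z : d (u (n + k)%N).1 z <= (u (n + k)%N).2 ->
    d (u n).1 z <= (u n).2.
  by elim: k => [|k IH]; rewrite ?addn0// addnS => /usub.
have ucen n m : (n <= m)%N -> d (u n).1 (u m).1 <= (u n).2.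
  move=> /subnKC<-; apply: (unest n (m - n)%N); rewrite dxx.
  exact/ltW.
have [|l Hl] := dcpl (fun n => (u n).1).
  move=> e e0; have [|N HN] := inv_succ_lt (e := e / 2).
    by rewrite divr_gt0.
  exists N => m n Nm Nn; apply: le_lt_trans (dtri _ (u N).1 _) _.
  rewrite [e]splitr; apply: ltrD.
    by rewrite dC (le_lt_trans (ucen _ _ Nm))// (le_lt_trans (u1 _))// HN.
  by rewrite (le_lt_trans (ucen _ _ Nn))// (le_lt_trans (u1 _))// HN.
have ul n : d (u n).1 l <= (u n).2.
  apply/ler_addgt0Pr => e e0.
  move/cvgrPdist_lt: Hl => /(_ e e0)[N _ HN].
  have /HN : (N <= maxn N n)%N by exact: leq_maxl.
  rewrite sub0r normrN ger0_norm ?d0// => le.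
  apply: le_trans (dtri _ (u (maxn N n)).1 _) _; apply: lerD (ltW le).
  by apply: ucen; exact: leq_maxr.
exists l; split; first by have [] := q0O l (ul 0%N).
case=> [|n] _; first by have [] := q0O l (ul 0%N).
by have [_ _ /(_ l (ul n.+1))[]] := Hf (n.+1, u n) (u0 n).
Qed.

(** * Lower and upper limits of nonnegative sequences *)

Lemma limn_einf_eq0P (R : realType) (u : nat -> R) : (forall n, 0 <= u n) ->
  limn_einf (fun n => (u n)%:E) = 0%E <->
  forall e N, 0 < e -> exists2 n, (N <= n)%N & u n < e.
Proof.
move=> u0; have cv := @cvg_einfs_sup _ (fun n => (u n)%:E).
rewrite limn_einf_lim (cvg_lim _ cv)//; split=> [h e N e0|h].
  have : (einfs (fun n => (u n)%:E) N < e%:E)%E.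
    rewrite (@le_lt_trans _ _ 0%E) ?lte_fin// -h.
    by apply: ereal_sup_ubound; exists N.
  by move=> /ereal_inf_lt[_ [n /= Nn <-]]; rewrite lte_fin; exists n.
apply/eqP; rewrite eq_le; apply/andP; split.
  apply: ge_ereal_sup => _ [N _ <-]; apply/lee_addgt0Pr => e e0.
  have [n Nn une] := h e N e0; rewrite add0e.
  apply: (@le_trans _ _ (u n)%:E); last by rewrite lee_fin ltW.
  by apply: ereal_inf_lbound; exists n.
apply: (@le_trans _ _ (einfs (fun n => (u n)%:E) 0)).
  by apply: le_ereal_inf_tmp => _ [n _ <-]; rewrite lee_fin.
by apply: ereal_sup_ubound; exists 0%N.
Qed.

Lemma limn_esup_gt0P (R : realType) (u : nat -> R) : (forall n, 0 <= u n) ->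
  (0 < limn_esup (fun n => (u n)%:E))%E <-> ~ (u @ \oo --> (0 : R)).
Proof.
move=> u0; split=> [h cu|ncu].
  have /cvg_limn_einf_sup[_ h0] : (fun n => (u n)%:E) @ \oo --> 0%:E.
    by apply: cvg_EFin => //; exact: nearW.
  by rewrite h0 ltxx in h.
rewrite ltNge; apply/negP => h; apply: ncu.
have : (fun n => (u n)%:E) @ \oo --> 0%E.
  by apply: limn_esup_le_cvg => // n; rewrite lee_fin.
by move=> /fine_cvgP[_].
Qed.

(** * Invariant metrics and the Banach-Steinhaus theorem *)

Lemma inv_metricE (R : realType) (K : numFieldType) (X : tvsType K)
    (d : X -> X -> R) (hd : invariant_metric d) (x y : X) :
  d x y = d 0 (y - x).
Proof. by case: hd => _ _ /(_ x y (- x)) <-; rewrite subrr. Qed.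

Lemma inv_metricB (R : realType) (K : numFieldType) (X : tvsType K)
    (d : X -> X -> R) (hd : invariant_metric d) (x y : X) :
  d 0 (x - y) <= d 0 x + d 0 y.
Proof.
case: (hd) => -[_ _ dC dtri] _ _.
by rewrite -(inv_metricE hd) (le_trans (dtri _ 0 _))// dC addrC.
Qed.

Lemma nbhs0_shift (K : numFieldType) (X : tvsType K) (a : X) (A : set X) :
  nbhs a A -> nbhs 0 [set x | A (a + x)].
Proof.
move=> aA.
have ca : continuous (fun x : X => a + x).
  move=> x; apply: (@continuous_comp _ _ _ (fun x => (a, x))
    (fun z : X * X => z.1 + z.2)); last exact: add_continuous.
  by apply: cvg_pair => /=; [exact: cvg_cst|exact: cvg_id].
by apply: (ca 0); rewrite addr0.
Qed.

Lemma continuous_additive0 (K : numFieldType) (X : tvsType K) (T : X -> X)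
    (Tadd : {morph T : x y / x - y}) :
  T @ 0 --> (0 : X) -> continuous T.
Proof.
move=> T0 x A /nbhs0_shift/T0 Ax.
have c : (fun y => y - x) @ x --> (0 : X).
  rewrite -(subrr x); apply: (@continuous_comp _ _ _ (fun y => (y, x))
    (fun z : X * X => z.1 - z.2)); last exact: sub_continuous.
  by apply: cvg_pair => /=; [exact: cvg_id|exact: cvg_cst].
have : nbhs x [set y | A (T x + T (y - x))] by exact: (c _ Ax).
by apply: filterS => y /=; rewrite Tadd addrC subrK.
Qed.

(** Banach-Steinhaus for pointwise convergent sequences. The closed sets [A N], on which the tail
    from [N] on varies by at most [e], cover the space, so by Baire one of them has an interior
    point [a]. Translating [a] to 0 controls all [T n] with n >= N, and continuity handles the
    finitely many others. *)
Lemma Frechet_equicontinuous (R : realType) (K : numFieldType) (X : tvsType K)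
    (hX : is_frechet R X) (T : nat -> X -> X)
    (Tadd : forall n, {morph T n : x y / x - y})
    (Tcont : forall n, continuous (T n))
    (Tcvg : forall x, exists l : X, T ^~ x @ \oo --> l) (V : set X) :
  nbhs 0 V -> \forall x \near 0, forall n, V (T n x).
Proof.
case: hX => d [hd dcpl]; have [dm dtop dinv] := hd.
have [d0 dx0 dC dtri] := dm.
have dE := inv_metricE hd; have dB := inv_metricB hd.
have T0 n : T n 0 = 0 by rewrite -{1}(subrr 0) Tadd subrr.
move=> /(nbhs_metricP dtop)[e0 e00 eV].
(* A quarter is enough: the final estimate adds three terms of size at most [e], namely [T N x] and
   the differences of [T N] and [T n] at [a + x] and at [a]. *)
pose e := e0 / 4; have e_gt0 : 0 < e by rewrite divr_gt0.
pose A N := [set x | forall m n, (N <= m)%N -> (N <= n)%N ->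
  d (T m x) (T n x) <= e].
have oA N : open (~` A N).
  rewrite openE => x /existsNP[m /existsNP[n /not_implyP[Nm]]].
  move=> /not_implyP[Nn /negP]; rewrite -ltNge => dmn.
  (* Half of the excess over [e]: moving both images by less than [h] keeps them more than [e]
     apart. *)
  pose h := (d (T m x) (T n x) - e) / 2.
  have h0 : 0 < h by rewrite divr_gt0// subr_gt0.
  have near_x k : \forall y \near x, d (T k x) (T k y) < h.
    have : nbhs (T k x) [set z | d (T k x) z < h].
      by apply/(nbhs_metricP dtop); exists h.
    by move/(Tcont k x).
  rewrite /interior; apply: filterS2 (near_x m) (near_x n) => y ym yn Ay.
  have := Ay m n Nm Nn; move: ym yn => /= ym; rewrite dC => yn.
  have := dtri (T m x) (T m y) (T n x).
  have := dtri (T m y) (T n y) (T n x).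
  rewrite /h in ym yn; lra.
(* Otherwise all complements of the [A N] are open and dense, and a point common to them would have
   a non-Cauchy sequence of images. *)
have [N [W [[a [oW Wa]] WA]]] : exists N, exists W,
    (exists x, open_nbhs x W) /\ (W `&` ~` A N = set0).
  apply: contrapT => /forallNP nA.
  have dA N : dense (~` A N).
    by apply: contrapT => /denseNE; exact: nA.
  have [|x [_ Ax]] := complete_metric_Baire dm dtop dcpl
    (fun N => conj (oA N) (dA N)) _ openT; first by exists 0.
  have [l /(cvg_metricP dtop) Hl] := Tcvg x.
  have [|N HN] := Hl (e / 2); first by rewrite divr_gt0.
  apply: (Ax N I) => m n /HN ml /HN nl.
  have := dtri (T m x) l (T n x); rewrite dC in ml; lra.
have nA : \forall x \near 0, A N (a + x).
  apply: nbhs0_shift; apply: filterS (open_nbhs_nbhs (conj oW Wa)) => x Wx.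
  by apply: contrapT => nAx; have : (W `&` ~` A N) x by []; rewrite WA.
have near0 k : \forall x \near 0, d 0 (T k x) < e.
  have : nbhs (T k 0) [set z | d 0 z < e].
    by apply/(nbhs_metricP dtop); exists e => // z; rewrite T0.
  by move/(Tcont k 0).
have nN : \forall x \near 0, forall k, (k <= N)%N -> d 0 (T k x) < e.
  have : \forall x \near 0, forall k : 'I_N.+1, d 0 (T k x) < e.
    by apply: filter_forall => k; exact: near0.
  by apply: filterS => x Hx k kN; exact: (Hx (Ordinal (kN : k < N.+1)%N)).
have Aa : A N a by have := nbhs_singleton nA; rewrite /= addr0.
apply: filterS2 nA nN => x Aax Tx n; apply: eV.
have [/Tx|/ltnW Nn] := leqP n N; first by rewrite /e; lra.
have := Aax n N Nn (leqnn N); have := Aa n N Nn (leqnn N).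
rewrite !(dE (T n _)) => h1 h2.
have TD k y z : T k (y + z) = T k y + T k z.
  by rewrite -{1}(opprK z) Tadd -(sub0r z) Tadd T0 sub0r opprK.
have Ex : T N x - T n x = (T N (a + x) - T n (a + x)) - (T N a - T n a).
  by rewrite !TD opprD addrACA [RHS]addrAC subrr add0r.
have := dB (T N x) (T N x - T n x); rewrite opprB addrC subrK.
have := dB (T N (a + x) - T n (a + x)) (T N a - T n a); rewrite -Ex.
have := Tx N (leqnn N); rewrite /e in h1 h2 *; lra.
Qed.

(** Equicontinuity at 0 passes to the pointwise limit, at the cost of half the radius, and
    additivity carries continuity from 0 to every point. *)
Lemma Frechet_limit_continuous (R : realType) (K : numFieldType) (X : tvsType K)
    (hX : is_frechet R X) (T : nat -> X -> X) (L : X -> X)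
    (Tadd : forall n, {morph T n : x y / x - y})
    (Tcont : forall n, continuous (T n))
    (Ladd : {morph L : x y / x - y})
    (TL : forall x, T ^~ x @ \oo --> L x) : continuous L.
Proof.
apply: continuous_additive0 => // V V0.
have Teq := Frechet_equicontinuous hX Tadd Tcont
  (fun x => ex_intro _ (L x) (TL x)).
case: hX => d [hd _]; have [[_ _ dC dtri] dtop _] := hd.
move: V0 => /(nbhs_metricP dtop)[e e0 eV].
have /Teq : nbhs (0 : X) [set z | d 0 z < e / 2].
  by apply/(nbhs_metricP dtop); exists (e / 2) => //; rewrite divr_gt0.
apply: filterS => x Tx; apply: eV.
have /(cvg_metricP dtop)/(_ (e / 2))[|N HN] := TL x; first by rewrite divr_gt0.
have := HN N (leqnn N); have := Tx N; rewrite /= dC => h1 h2.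
have := dtri 0 (T N x) (L x); rewrite (dC (T N x)) (dC 0 (T N x)); lra.
Qed.

Lemma Frechet_Baire (R : realType) (K : numFieldType) (X : tvsType K)
    (hX : is_frechet R X) (F : nat -> set X) :
  (forall n, open (F n) /\ dense (F n)) -> dense (\bigcap_n F n).
Proof.
case: hX => d [[dm dtop _] dcpl].
exact: complete_metric_Baire dm dtop dcpl _.
Qed.

(** * Limits in topological vector spaces, coordinates and bilateral series *)

Lemma tvs_cvgD (K : numFieldType) (X : tvsType K) (T : Type) (F : set_system T)
    {FF : Filter F} (f g : T -> X) (a b : X) :
  f @ F --> a -> g @ F --> b -> (fun t => f t + g t) @ F --> a + b.
Proof.
move=> fa gb; apply: (@cvg_comp _ _ _ (fun t => (f t, g t))
  (fun z : X * X => z.1 + z.2) F (nbhs (a, b))); first exact: cvg_pair.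
exact: (@add_continuous X (a, b)).
Qed.

Lemma tvs_cvgB (K : numFieldType) (X : tvsType K) (T : Type) (F : set_system T)
    {FF : Filter F} (f g : T -> X) (a b : X) :
  f @ F --> a -> g @ F --> b -> (fun t => f t - g t) @ F --> a - b.
Proof.
move=> fa gb; apply: (@cvg_comp _ _ _ (fun t => (f t, g t))
  (fun z : X * X => z.1 - z.2) F (nbhs (a, b))); first exact: cvg_pair.
exact: (@sub_continuous X (a, b)).
Qed.

Lemma tvs_cvgZ (K : numFieldType) (X : tvsType K) (T : Type) (F : set_system T)
    {FF : Filter F} (f : T -> K^o) (g : T -> X) (a : K^o) (b : X) :
  f @ F --> a -> g @ F --> b ->
  (fun t => (f t : K) *: g t) @ F --> (a : K) *: b.
Proof.
move=> fa gb; apply: (@cvg_comp _ _ _ (fun t => (f t, g t))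
  (fun z : K^o * X => z.1 *: z.2) F (nbhs ((a, b) : K^o * X))).
  exact: (cvg_pair (G := nbhs (a : K^o)) (H := nbhs b) fa gb).
exact: (@scale_continuous K X (a, b)).
Qed.

Lemma tvs_cvg_scale0 (K : numFieldType) (X : tvsType K) (T : Type)
    (F : set_system T) {FF : Filter F} (f : T -> X) (c : K) :
  f @ F --> 0 -> (fun t => c *: f t) @ F --> 0.
Proof.
move=> f0; rewrite -(scaler0 _ c).
exact: (@tvs_cvgZ _ _ _ F FF (fun=> c) f c 0 (cvg_cst _)).
Qed.

Lemma tvs_sum_continuous (K : numFieldType) (X : tvsType K)
    (M : topologicalType) (I : Type) (r : seq I) (f : I -> M -> X) :
  (forall i, continuous (f i)) -> continuous (fun x => \sum_(i <- r) f i x).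
Proof.
move=> fc x; elim: r => [|i r IH].
  rewrite /continuous_at big_nil; under eq_fun do rewrite big_nil.
  exact: cvg_cst.
rewrite /continuous_at big_cons; under eq_fun do rewrite big_cons.
by apply: tvs_cvgD; [exact: fc|exact: IH].
Qed.

Lemma coord_continuous (K : numFieldType) (S : pred (int -> K))
    (X : seqSpaceType S) (j : int) :
  continuous (fun x : X => (val x : int -> K) j : K^o).
Proof.
move=> x; apply: (@continuous_comp _ _ _ (val : X -> {ptws int -> K})
  (fun f => f j)); first exact: val_continuous.
exact: (@proj_continuous int (fun=> K) j).
Qed.

Lemma coord_scale_continuous (K : numFieldType) (S : pred (int -> K))
    (X : seqSpaceType S) (c : K) (j : int) (v : X) :
  continuous (fun x : X => (c * (val x : int -> K) j) *: v).
Proof.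
move=> x; rewrite /continuous_at -scalerA; under eq_fun do rewrite -scalerA.
apply: tvs_cvgZ; first exact: cvg_cst.
by apply: tvs_cvgZ; [exact: coord_continuous|exact: cvg_cst].
Qed.

Lemma bilateral_cvg_comp (K : numFieldType) (X : tvsType K) (u : int -> X)
    (l : X) (f g : nat -> nat) : bilateral_cvg u l ->
  f @ \oo --> \oo -> g @ \oo --> \oo ->
  (fun N => \sum_(0 <= k < f N) u k%:Z + \sum_(1 <= k < g N) u (- k%:Z))
    @ \oo --> l.
Proof.
move=> ul fo go; have fg := cvg_pair fo go.
exact: (cvg_comp _ _ (fg _ _ _) ul).
Qed.

(** Two partial sums with the same right cutoff and consecutive left cutoffs have the same limit and
    differ by a single term. *)
Lemma bilateral_cvg_term0 (K : numFieldType) (X : tvsType K) (u : int -> X)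
    (l : X) : bilateral_cvg u l -> (fun n : nat => u (- n.+1%:Z)) @ \oo --> 0.
Proof.
move=> ul; rewrite -(subrr l).
have shift k : (fun N => \sum_(0 <= i < N) u i%:Z
    + \sum_(1 <= i < N + k) u (- i%:Z)) @ \oo --> l.
  by apply: (bilateral_cvg_comp ul);
    [exact: cvg_id|exact: cvg_addnr].
apply: cvg_trans (tvs_cvgB (shift 2%N) (shift 1%N)).
apply: near_eq_cvg; apply: nearW => n /=.
rewrite addn2 addn1 (big_nat_recr n.+1)//= opprD addrACA subrr add0r.
by rewrite addrAC subrr add0r.
Qed.

(** * Products of weights and iterates of the shift *)

Lemma wprodD (K : numFieldType) (w : int -> K) (i : int) (m n : nat) :
  wprod w i (m + n) = wprod w i m * wprod w (i + m%:Z) n.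
Proof.
elim: n => [|n IH]; first by rewrite addn0 {3}/wprod big_nil mulr1.
rewrite addnS /wprod !big_nat_recr//= -!/(wprod _ _ _) IH -mulrA.
by rewrite PoszD addrA.
Qed.

Lemma wprod_neq0 (K : numFieldType) (w : int -> K) (hw : forall n, w n != 0)
    (i : int) (n : nat) : wprod w i n != 0.
Proof. by rewrite prodf_seq_neq0; apply/allP => l _; rewrite hw. Qed.

Section shift.
Variables (K : numFieldType) (S : pred (int -> K)) (X : seqSpaceType S).
Variables (w : int -> K) (B : X -> X).
Hypothesis hB : forall x : X, val (B x) = bshift w (val x).

Lemma shift_scale (c : K) : {morph B : x / c *: x}.
Proof.
move=> x; apply: val_inj; rewrite hB !linearZ/= hB.
by apply/funext => n; rewrite /bshift /GRing.scale/= mulrCA.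
Qed.

Lemma shift_sub : {morph B : x y / x - y}.
Proof.
move=> x y; apply: val_inj; rewrite hB !raddfB/= !hB.
by apply/funext => n; rewrite /bshift /= mulrBr.
Qed.

Lemma shift_iter (n : nat) (x : X) :
  val (iter n B x) = fun j => wprod w j n * (val x : int -> K) (j + n%:Z).
Proof.
elim: n => [|n IH] /=.
  by apply/funext => j; rewrite /wprod big_nil mul1r addr0.
rewrite hB IH; apply/funext => j; rewrite /bshift mulrA -addrA -PoszD add1n.
congr (_ * _); rewrite -add1n wprodD /wprod big_nat1 addr0.
by [].
Qed.

Lemma shift_iterZ (n : nat) (c : K) : {morph iter n B : x / c *: x}.
Proof. by move=> x; elim: n => //= n ->; rewrite shift_scale. Qed.

Lemma shift_iterB (n : nat) : {morph iter n B : x y / x - y}.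
Proof. by move=> x y; elim: n => //= n ->; rewrite shift_sub. Qed.

Lemma shift_iterD (n : nat) : {morph iter n B : x y / x + y}.
Proof.
move=> x y; rewrite -{1}(opprK y) shift_iterB -(scaleN1r y) shift_iterZ.
by rewrite scaleN1r opprK.
Qed.

Lemma shift_iter0 (n : nat) : iter n B 0 = 0.
Proof. by have := shift_iterB n 0 0; rewrite !subrr. Qed.

Lemma shift_iter_basis (e : int -> X) (he : canonical_vectors e)
    (m : nat) (n : int) :
  iter m B (e n) = wprod w (n - m%:Z) m *: e (n - m%:Z).
Proof.
apply: val_inj; rewrite shift_iter linearZ/= !he; apply/funext => j.
rewrite /GRing.scale/= subr_eq; have [->|_] := eqVneq n (j + m%:Z).
  by rewrite addrK.
by rewrite mulr0 scaler0.
Qed.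

(** The partial sums [T N] of the expansion of [B x] involve finitely many coordinates of [x], hence
    are continuous, and [B] is their pointwise limit. *)
Lemma shift_continuous (R : realType) (hX : is_frechet R X) (e : int -> X)
    (he : canonical_basis e) : continuous B.
Proof.
pose T N x := \sum_(0 <= k < N) (val (B x) : int -> K) k%:Z *: e k%:Z
  + \sum_(1 <= k < N) (val (B x) : int -> K) (- k%:Z) *: e (- k%:Z).
apply: (Frechet_limit_continuous hX (T := T)).
- move=> N x y; rewrite /T opprD addrACA -!sumrB.
  by congr (_ + _); apply: eq_bigr => k _; rewrite shift_sub raddfB scalerBl.
- move=> N x; rewrite /continuous_at /T hB.
  under eq_fun do rewrite hB.
  apply: tvs_cvgD; apply: tvs_sum_continuous => k;
    exact: coord_scale_continuous.
- exact: shift_sub.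
- move=> x; have [_ /(_ (B x)) hx] := he.
  by apply: (bilateral_cvg_comp hx); exact: cvg_id.
Qed.

Lemma iter_continuous (n : nat) : continuous B -> continuous (iter n B).
Proof.
move=> cB; elim: n => [|n IH] x; first exact: cvg_id.
by apply: continuous_comp; [exact: IH|exact: cB].
Qed.

End shift.

(** The terms of a convergent expansion tend to 0, so these maps converge pointwise to 0 and
    Banach-Steinhaus applies. *)
Lemma basis_equicontinuous (R : realType) (K : numFieldType)
    (S : pred (int -> K)) (X : seqSpaceType S) (hX : is_frechet R X)
    (e : int -> X) (he : canonical_basis e) (V : set X) :
  nbhs 0 V -> \forall x \near (0 : X), forall n : nat,
    V ((val x : int -> K) (- n.+1%:Z) *: e (- n.+1%:Z)).
Proof.
apply: (Frechet_equicontinuous hX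
  (T := fun n x => (val x : int -> K) (- n.+1%:Z) *: e (- n.+1%:Z))).
- by move=> n x y; rewrite raddfB scalerBl.
- move=> n x.
  have := @coord_scale_continuous _ _ X 1 (- n.+1%:Z) (e (- n.+1%:Z)).
  by move=> /(_ x); rewrite /continuous_at mul1r; under eq_fun do rewrite mul1r.
- move=> x; exists 0.
  by have [_ /(_ x) /bilateral_cvg_term0] := he.
Qed.

(** * Semi-irregular vectors and Li-Yorke chaos *)

Definition frequently_in_nbhs0 (K : numFieldType) (X : tvsType K)
    (u : nat -> X) :=
  forall V, nbhs 0 V -> forall N, exists2 n, (N <= n)%N & V (u n).

Definition semi_irregular (K : numFieldType) (X : tvsType K) (T : X -> X)
    (z : X) : Prop :=
  frequently_in_nbhs0 (fun n => iter n T z) /\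
  ~ ((fun n => iter n T z) @ \oo --> 0).

Lemma inv_metric_cvg0P (R : realType) (K : numFieldType) (X : tvsType K)
    (d : X -> X -> R) (hd : invariant_metric d) (u v : nat -> X) :
  (fun n => d (u n) (v n)) @ \oo --> (0 : R) <->
  (fun n => v n - u n) @ \oo --> 0.
Proof.
have [[d0 _ _ _] dtop _] := hd.
have E n : `|0 - d (u n) (v n)| = d 0 (v n - u n).
  by rewrite sub0r normrN ger0_norm ?d0// (inv_metricE hd).
split=> [/cvgrPdist_lt h|/(cvg_metricP dtop) h].
  apply/(cvg_metricP dtop) => e /h[N _ HN].
  by exists N => n /HN; rewrite /= E.
apply/cvgrPdist_lt => e /h[N HN].
by exists N => // n /HN; rewrite /= E.
Qed.

(** By invariance, the distance between the two orbits at time n is the distance from 0 to the n-th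
    iterate of [y - x]. *)
Lemma li_yorke_pairP (R : realType) (K : numFieldType) (X : tvsType K)
    (d : X -> X -> R) (hd : invariant_metric d) (T : X -> X)
    (Tsub : forall n, {morph iter n T : x y / x - y}) (x y : X) :
  limn_einf (fun n => (d (iter n T x) (iter n T y))%:E) = 0%E /\
  (0 < limn_esup (fun n => (d (iter n T x) (iter n T y))%:E))%E <->
  semi_irregular T (y - x).
Proof.
have [[d0 _ _ _] dtop _] := hd.
have E : (fun n => iter n T (y - x)) = (fun n => iter n T y - iter n T x).
  by apply/funext => n; rewrite Tsub.
rewrite /semi_irregular E limn_einf_eq0P// limn_esup_gt0P//.
rewrite inv_metric_cvg0P//; split=> -[h1 h2]; split => //.
  move=> V /(nbhs_metricP dtop)[e e0 eV] N.
  have [n Nn de] := h1 e N e0.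
  by exists n => //; apply: eV; rewrite /= -(inv_metricE hd).
move=> e N e0; have [|n Nn de] := h1 [set z | d 0 z < e] _ N.
  by apply/(nbhs_metricP dtop); exists e.
by exists n => //; rewrite (inv_metricE hd).
Qed.

(** Otherwise the unit interval would have Lebesgue measure 0 instead of 1. *)
Lemma uncountable_real (R : realType) : ~ countable [set: R].
Proof.
move=> cR; have c01 : countable `[(0 : R), 1]%classic.
  by apply: sub_countable cR; exact: subset_card_le.
have := countable_lebesgue_measure0 c01.
rewrite lebesgue_measure_itv/= lte_fin ltr01 oppr0 adde0.
by move=> /eqP; rewrite eqe oner_eq0.
Qed.

Lemma real_injection (R : realType) (K : numFieldType)
    (hK : K = (R : numFieldType) \/ K = (R[i] : numFieldType)) :
  exists f : R -> K, injective f.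
Proof.
case: hK => ->; first by exists id.
by exists (real_complex R); exact: fmorph_inj.
Qed.

Lemma semi_irregularZ (K : numFieldType) (X : tvsType K) (T : X -> X)
    (Tscale : forall n (c : K), {morph iter n T : x / c *: x}) (c : K) (z : X) :
  c != 0 -> semi_irregular T z -> semi_irregular T (c *: z).
Proof.
move=> c0 [h1 h2]; split=> [V V0 N|h].
  have : \forall x \near (0 : X), V (c *: x).
    by have := tvs_cvg_scale0 c (@cvg_id _ (nbhs (0 : X))); exact.
  by move=> /h1/(_ N)[n Nn Vn]; exists n => //; rewrite Tscale.
apply: h2.
rewrite (_ : (fun n => iter n T z) = fun n => c^-1 *: iter n T (c *: z)).
  exact: tvs_cvg_scale0.
by apply/funext => n; rewrite Tscale scalerA mulVf// scale1r.
Qed.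

Lemma li_yorke_semi_irregular (R : realType) (K : numFieldType)
    (hK : K = (R : numFieldType) \/ K = (R[i] : numFieldType))
    (X : tvsType K) (d : X -> X -> R) (hd : invariant_metric d) (T : X -> X)
    (Tsub : forall n, {morph iter n T : x y / x - y})
    (Tscale : forall n (c : K), {morph iter n T : x / c *: x})
    (Tcont : continuous T) :
  li_yorke_chaotic d T <-> exists z, semi_irregular T z.
Proof.
split=> [[_ [S [nS hS]]]|[z hz]].
  apply: contrapT => nz; apply: nS.
  (* Without semi-irregular vectors a scrambled set has at most one point, hence is countable. *)
  have S1 x y : S x -> S y -> x = y.
    move=> Sx Sy; apply: contrapT => xy; apply: nz; exists (y - x).
    by apply/(li_yorke_pairP hd) => //; exact: hS.
  have [S0|/set0P[x Sx]] := eqVneq S set0; first by rewrite S0.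
  rewrite (_ : S = [set x]); first exact: countable1.
  by apply/seteqP; split=> [y Sy|_ ->//]; exact: S1.
split=> //; have [f finj] := real_injection hK.
have z0 : z != 0.
  apply/eqP => z0; case: hz => _; apply; rewrite z0.
  have T0 n : iter n T 0 = 0 by have := Tsub n 0 0; rewrite !subrr.
  by under eq_fun do rewrite T0; exact: cvg_cst.
(* The real multiples of [z] form an uncountable set, and the difference of two distinct ones is a
   nonzero multiple of [z]. *)
exists [set f t *: z | t in [set: R]]; split.
  rewrite (eq_countable (inj_card_eq _)); first exact: uncountable_real.
  move=> s t _ _ /eqP; rewrite -subr_eq0 -scalerBl scaler_eq0 (negPf z0) orbF.
  by rewrite subr_eq0 => /eqP/finj.
move=> _ _ [s _ <-] [t _ <-] st; apply/(li_yorke_pairP hd) => //.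
rewrite -scalerBl; apply: semi_irregularZ => //; rewrite subr_eq0.
by apply/eqP => fst; apply: st; rewrite fst.
Qed.

Lemma eq_seq_cvg (T : topologicalType) (u v : nat -> T) (l : T) :
  u @ \oo --> l -> u =1 v -> v @ \oo --> l.
Proof. by move=> + /funext<-. Qed.

Lemma frequently_subsequence (R : realType) (K : numFieldType) (X : tvsType K)
    (d : X -> X -> R) (hd : invariant_metric d) (u : nat -> X) :
  frequently_in_nbhs0 u ->
  exists phi : nat -> nat,
    [/\ (0 < phi 0)%N, increasing_seq phi & u (phi k) @[k --> \oo] --> (0 : X)].
Proof.
move=> hu; have [_ dtop _] := hd.
(* The strict inequality makes [phi] increasing and [phi 0] positive. *)
have /choice[g Hg] N : exists m, (N < m)%N /\ d 0 (u m) < N.+1%:R^-1.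
  have [|m Nm um] := hu [set z | d 0 z < N.+1%:R^-1] _ N.+1; last by exists m.
  by apply/(nbhs_metricP dtop); exists N.+1%:R^-1 => //; rewrite invr_gt0 ltr0n.
pose phi := fix phi k := if k is l.+1 then g (phi l) else g 0%N.
have phiS k : (phi k < phi k.+1)%N by have [] := Hg (phi k).
have phi_ge k : (k <= phi k)%N.
  by elim: k => // k IH; exact: leq_ltn_trans (phiS k).
exists phi; split; first by have [] := Hg 0%N.
  by apply/increasing_seqP => k; rewrite ltEnat; exact: phiS.
apply/(cvg_metricP dtop) => e /inv_succ_lt[N HN].
exists N.+1 => -[//|k] Nk; have [_ /lt_trans] := Hg (phi k); apply.
by apply: HN; apply: leq_trans (phi_ge k); rewrite -ltnS.
Qed.

Lemma dense_frequent_semi_irregular (R : realType) (K : numFieldType)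
    (X : tvsType K) (hX : is_frechet R X) (T : X -> X)
    (Tsub : forall n, {morph iter n T : x y / x - y})
    (Tcont : forall n, continuous (iter n T)) (D : set X) (Ddense : dense D)
    (hD : forall y, D y -> frequently_in_nbhs0 (fun n => iter n T y)) (x : X) :
  ~ ((fun n => iter n T x) @ \oo --> 0) -> exists z, semi_irregular T z.
Proof.
move=> nx; apply: contrapT => nz; apply: nx.
have [d [hd _]] := hX; have [_ dtop _] := hd.
(* One index bounds both the time from below and the distance to 0 from above, so membership in
   every [U N] means that the orbit accumulates at 0. *)
pose U N := [set y | exists2 n, (N <= n)%N & d 0 (iter n T y) < N.+1%:R^-1].
have ball0 N : nbhs (0 : X) [set z | d 0 z < N.+1%:R^-1].
  by apply/(nbhs_metricP dtop); exists N.+1%:R^-1 => //; rewrite invr_gt0 ltr0n.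
have oU N : open (U N).
  rewrite openE => y [n Nn yn]; have [dm _ _] := hd.
  have : nbhs (iter n T y) [set z | d 0 z < N.+1%:R^-1].
    by apply: open_nbhs_nbhs; split => //; exact: metric_ball_open.
  move/(Tcont n y) => yT.
  have : nbhs y [set z | d 0 (iter n T z) < N.+1%:R^-1] by exact: yT.
  by apply: filterS => z zn; exists n.
have dU N : dense (U N).
  move=> W W0 oW; have [y [Wy Dy]] := Ddense _ W0 oW.
  by exists y; split => //; have [n] := hD y Dy _ (ball0 N) N; exists n.
(* As no semi-irregular vector is assumed to exist, an orbit accumulating at 0 must converge to
   0. *)
have Usmall y : (forall N, U N y) -> (fun n => iter n T y) @ \oo --> 0.
  move=> Uy; apply: contrapT => ny; apply: nz; exists y; split => //.
  move=> V /(nbhs_metricP dtop)[e e0 eV] N; have [M HM] := inv_succ_lt e0.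
  have [n Mn yn] := Uy (maxn M N); exists n.
    by apply: leq_trans Mn; exact: leq_maxr.
  by apply: eV; apply: lt_trans yn _; apply: HM; exact: leq_maxl.
have subc : continuous (fun y : X => x - y).
  by move=> y; apply: tvs_cvgB; [exact: cvg_cst|exact: cvg_id].
(* The reflection y |-> x - y is a homeomorphism, so these sets are open and dense too. A point [y]
   common to all [U N] and [U' N] splits [x] as (x - y) + y, with both orbits tending to 0. *)
pose U' N := [set y | U N (x - y)].
have oU' N : open (U' N).
  by apply: open_comp (oU N) => y _; exact: subc.
have dU' N : dense (U' N).
  move=> W [y Wy] oW; have [||z [Wz Uz]] := dU N [set z | W (x - z)].
  - by exists (x - y); rewrite /= opprB addrC subrK.
  - by apply: open_comp oW => z _; exact: subc.
  - by exists (x - z); split => //; rewrite /U' /= opprB addrC subrK.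
have [||y [_ Uy]] := Frechet_Baire hX (F := fun N => U N `&` U' N) _ _ openT.
- by move=> N; split; [exact: openI|exact: denseI].
- by exists 0.
have := tvs_cvgD (Usmall (x - y) (fun N => (Uy N I).2))
  (Usmall y (fun N => (Uy N I).1)).
rewrite addr0; move=> /(_ _)/eq_seq_cvg; apply => n.
by rewrite Tsub subrK.
Qed.

(** * Orbits of the weighted shift *)

(** Both products start at index j - n; one ends at -1, the other at j - 1. They differ by the fixed
    block of weights between 0 and j, by which one divides for j >= 0 and multiplies for j < 0. *)
Lemma wprod_end_const (K : numFieldType) (w : int -> K)
    (hw : forall n, w n != 0) (j : int) :
  exists2 c : K, c != 0 & forall n, (`|j| <= n)%N ->
    wprod w (- (`|n%:Z - j|%N)%:Z) `|n%:Z - j|%N = c * wprod w (j - n%:Z) n.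
Proof.
case: j => k.
  exists (wprod w 0 k)^-1; first by rewrite invr_eq0 wprod_neq0.
  move=> n kn; have [m ->] : exists m, n = (m + k)%N.
    by exists (n - k)%N; rewrite subnK.
  rewrite PoszD addrK absz_nat opprD addrCA subrr addr0 wprodD addNr.
  by rewrite mulrC mulfK// wprod_neq0.
exists (wprod w (Negz k) k.+1); first exact: wprod_neq0.
move=> n _; have -> : `|n%:Z - Negz k|%N = (n + k.+1)%N by lia.
have -> : - (n + k.+1)%:Z = Negz k - n%:Z by lia.
by rewrite wprodD subrK mulrC.
Qed.

Section shift_orbits.
Variables (R : realType) (K : numFieldType) (S : pred (int -> K)).
Variables (X : seqSpaceType S) (hX : is_frechet R X).
Variables (e : int -> X) (he : canonical_basis e).
Variables (w : int -> K) (hw : forall n, w n != 0).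
Variables (B : X -> X) (hB : forall x : X, val (B x) = bshift w (val x)).

Lemma semi_irregular_frequent_basis (z : X) : semi_irregular B z ->
  frequently_in_nbhs0 (fun n => wprod w (- n%:Z) n *: e (- n%:Z)).
Proof.
move=> [zf nz] V V0 N.
have [j zj] : exists j, (val z : int -> K) j != 0.
  apply: contrapT => /forallNP z0; apply: nz.
  have -> : z = 0.
    apply: val_inj; rewrite raddf0; apply/funext => j.
    by apply/eqP/negPn/negP/z0.
  rewrite (_ : (fun n => iter n B 0) = fun=> 0); first exact: cvg_cst.
  by apply/funext => n; exact: shift_iter0 hB n.
have [c c0 Hc] := wprod_end_const hw j.
(* Chosen so that [a] times the coordinate of index j - n of the n-th iterate of [z] is exactly the
   product of weights ending at -1. *)
pose a := c / (val z : int -> K) j.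
have V0' : \forall x \near (0 : X), V (a *: x).
  by have := tvs_cvg_scale0 a (@cvg_id _ (nbhs (0 : X))); exact.
(* A time beyond N + |j| makes n - j positive and larger than [N]. *)
have [n Nn /(_ _)] := zf _ (basis_equicontinuous hX he V0') (N + `|j|).+1.
have [m En] : exists m : nat, n%:Z - j = m.+1%:Z.
  by exists (`|n%:Z - j|.-1)%N; lia.
move=> /(_ m); rewrite -En opprB (shift_iter hB) subrK scalerA.
rewrite (_ : a * _ = c * wprod w (j - n%:Z) n); last first.
  by rewrite mulrCA mulrC /a divfK.
rewrite -Hc; last by lia.
by rewrite En absz_nat -opprB En; exists m.+1 => //; lia.
Qed.

Lemma shift_semi_irregular (phi : nat -> nat) (x : X) :
  increasing_seq phi ->
  wprod w (- (phi k)%:Z) (phi k) *: e (- (phi k)%:Z) @[k --> \oo] --> (0 : X) ->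
  ~ ((fun n => iter n B x) @ \oo --> 0) -> exists z, semi_irregular B z.
Proof.
move=> phi_inc phi0; have [hcan hbas] := he.
have cB := shift_continuous hB hX he.
(* Convergence along translates of one fixed sequence [phi] is what makes [D] stable under sums: two
   delays [J] can be replaced by their maximum. Mere accumulation at 0 would not give this. *)
pose D := [set y | exists J, (fun k => iter (phi k + J) B y) @ \oo --> 0].
have phi_ge k : (k <= phi k)%N.
  elim: k => // k IH; apply: leq_ltn_trans IH _.
  by move/increasing_seqP: phi_inc => /(_ k); rewrite ltEnat.
have iter_cvg0 n (u : nat -> X) : u @ \oo --> 0 -> iter n B \o u @ \oo --> 0.
  move=> u0; have := @iter_continuous _ _ _ _ n cB 0.
  rewrite /continuous_at (shift_iter0 hB) => h; exact: cvg_comp u0 h.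
have DZ c y : D y -> D (c *: y).
  move=> [J yJ]; exists J.
  rewrite (_ : (fun k => _) = fun k => c *: iter (phi k + J) B y).
    exact: tvs_cvg_scale0.
  by apply/funext => k; rewrite (shift_iterZ hB).
have DS y J J' : (J <= J')%N -> (fun k => iter (phi k + J) B y) @ \oo --> 0 ->
    (fun k => iter (phi k + J') B y) @ \oo --> 0.
  move=> JJ' /(iter_cvg0 (J' - J)%N); move/eq_seq_cvg; apply.
  by move=> k /=; rewrite -iterD addnCA subnK.
have DD y y' : D y -> D y' -> D (y + y').
  move=> [J yJ] [J' yJ']; exists (maxn J J').
  rewrite (_ : (fun k => _) = fun k => iter (phi k + maxn J J') B y
                                   + iter (phi k + maxn J J') B y').
    rewrite -(addr0 0); apply: tvs_cvgD; apply: DS; try eassumption.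
      exact: leq_maxl.
    exact: leq_maxr.
  by apply/funext => k; rewrite (shift_iterD hB).
have D0 : D 0.
  exists 0%N; rewrite (_ : (fun k => _) = fun=> 0); first exact: cvg_cst.
  by apply/funext => k; exact: shift_iter0 hB _.
have De0 : D (e 0).
  exists 0%N; move: phi0; move/eq_seq_cvg; apply => k.
  by rewrite addn0 (shift_iter_basis hB hcan) sub0r.
have DB y n : D (iter n B y) -> D y.
  move=> [J yJ]; exists (J + n)%N; move: yJ; move/eq_seq_cvg; apply.
  by move=> k; rewrite -iterD addnA.
have DB' y n : D y -> D (iter n B y).
  move=> [J yJ]; exists J; have := iter_cvg0 n _ yJ.
  move/eq_seq_cvg; apply => k /=.
  by rewrite -!iterD addnC.
(* For n >= 0 an iterate of [e n] is a multiple of [e 0]; for n < 0 the vector [e n] is a multiple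
   of an iterate of [e 0]. *)
have De n : D (e n).
  case: n => n.
    apply: (DB _ n); rewrite (shift_iter_basis hB hcan) subrr.
    exact: DZ.
  have := DB' _ n.+1 De0; rewrite (shift_iter_basis hB hcan) sub0r -NegzE.
  move=> /(DZ (wprod w (Negz n) n.+1)^-1).
  by rewrite scalerA mulVf ?scale1r// wprod_neq0.
apply: (@dense_frequent_semi_irregular _ _ _ hX B _ _ D).
- by move=> n; exact: shift_iterB hB n.
- by move=> n; exact: iter_continuous.
- move=> W [y Wy] oW.
  (* Density of [D]: the partial sums of the expansion of [y] lie in [D], and one of them falls in
     [W]. *)
  have /(_ W (open_nbhs_nbhs (conj oW Wy)))[N _ /(_ N (leqnn N)) WN] :=
    bilateral_cvg_comp (hbas y) (@cvg_id _ \oo) (@cvg_id _ \oo).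
  eexists; split; first exact: WN.
  by apply: (DD); apply: (big_ind D D0 DD) => k _; exact: DZ.
- move=> y [J yJ] V V0 N; have [M _ HM] := yJ V V0.
  exists (phi (maxn M N) + J)%N; last first.
    by apply: (HM (maxn M N)); exact: leq_maxl.
  by rewrite (leq_trans (leq_maxr M N))// (leq_trans (phi_ge _))// leq_addr.
Qed.

End shift_orbits.

(** * The characterization of Li-Yorke chaos by (a) and (b) *)

Theorem theorem22 (R : realType) (K : numFieldType)
    (hK : K = (R : numFieldType) \/ K = (R[i] : numFieldType))
    (S : pred (int -> K)) (X : seqSpaceType S)
    (hX : is_frechet R X)
    (d : X -> X -> R) (hd : invariant_metric d)
    (e : int -> X) (he : canonical_basis e)
    (w : int -> K) (hw : forall n, w n != 0)
    (B : X -> X) (hB : forall x : X, val (B x) = bshift w (val x)) :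
  li_yorke_chaotic d B <->
  ((exists phi : nat -> nat,
      [/\ (0 < phi 0)%N,
          increasing_seq phi
        & wprod w (- (phi k)%:Z) (phi k) *: e (- (phi k)%:Z)
            @[k --> \oo] --> (0 : X)]) /\
   (exists (x : X) (y : nat -> X),
      (forall n, val (y n) =
                 fun j => wprod w j n * (val x : int -> K) (j + n%:Z)) /\
      ~ (y @ \oo --> (0 : X)))).
Proof.
rewrite (li_yorke_semi_irregular hK hd); last 3 first.
- by move=> n; exact: shift_iterB hB n.
- by move=> n; exact: shift_iterZ hB n.
- exact: (shift_continuous hB hX he).
split=> [[z hz]|[[phi [_ phi_inc phi0]] [x [y [hy ny]]]]].
  split.
    apply: (frequently_subsequence hd
      (u := fun n => wprod w (- n%:Z) n *: e (- n%:Z))).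
    exact: (semi_irregular_frequent_basis hX he hw hB hz).
  (* The semi-irregular vector itself serves in (b), since its orbit does not converge to 0. *)
  exists z, (fun n => iter n B z); split; last by case: hz.
  by move=> n; exact: shift_iter.
apply: (shift_semi_irregular hX he hw hB (x := x) phi_inc phi0).
rewrite (_ : (fun n => iter n B x) = y)//; apply/funext => n.
by apply: val_inj; rewrite hy (shift_iter hB).
Qed.
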